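(* Let $N\ge 2$ be a natural number with factorization into prime numbers $N=\prod_{j=1}^n p_j^{k_j}$, $p_1>p_2>\dots>p_n$, and let $F_N$ be the $N\times N$ unitary Fourier matrix, $[F_N]_{i,j}=\frac{1}{\sqrt N}e^{\mathbf i\frac{2\pi}{N}(i-1)(j-1)}$, $i,j\in\{1,\dots,N\}$. Then the defect of $F_N$ satisfies: a) $\displaystyle \mathbf d(F_N)=\sum_{l=1}^{N-1}\big(\gcd(N,l)-1\big)$; b) $\displaystyle \mathbf d(F_N)=N\cdot\Big(\prod_{j=1}^n\Big(1+k_j-\frac{k_j}{p_j}\Big)-2\Big)+1$.
   Context: Let $f$ be the map sending a complex $N\times N$ matrix $U$ to the real matrix $(|U_{i,j}|^2)_{i,j}$, regarded as a smooth map between real vector spaces, with differential at $U$ given by $Df_U(V)=\big(2\,\mathrm{Re}(\overline{U_{i,j}}V_{i,j})\big)_{i,j}$. For an $N\times N$ unitary matrix $U$ let $T_U=\{EU: E\in\mathbb C^{N\times N},\ E^*=-E\}$ be the (real) tangent space at $U$ to the manifold of unitary matrices. The defect of $U$ is the integer $\mathbf d(U)=(N-1)^2-\dim_{\mathbb R}Df_U(T_U)$. *)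

(* Defs.v *)
From HB Require Import structures.
From mathcomp Require Import all_boot all_order all_algebra.
From mathcomp Require Import complex.
From mathcomp Require Import ring.
From mathcomp Require Import boolp classical_sets reals trigo.
Set Implicit Arguments.
Unset Strict Implicit.
Unset Printing Implicit Defensive.
Import Order.TTheory GRing.Theory Num.Theory.
Local Open Scope complex_scope.
Local Open Scope ring_scope.
Local Open Scope sesquilinear_scope.
Local Open Scope classical_set_scope.

Section VectorSubspace.
Context {K : fieldType} {vT : vectType K}.

Definition is_subspace (S : set vT) : Prop :=
  S 0 /\ forall (a : K) (u v : vT), S u -> S v -> S (a *: u + v).

Lemma subspace_vspace (S : set vT) : is_subspace S ->
  exists W : {vspace vT}, forall v, v \in W <-> S v.
Proof.
move=> [S0 Slin].
pose P n := `[< exists W : {vspace vT}, (forall v, v \in W -> S v) /\ \dim W = n >].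
have exP : exists n, P n.
  exists 0%N; apply/asboolP; exists 0%VS; split; last by rewrite dimv0.
  by move=> v; rewrite memv0 => /eqP ->.
have ubP n : P n -> (n <= dim vT)%N.
  by move=> /asboolP[W [_ <-]]; rewrite -dimvf dimvS ?subvf.
case: (ex_maxnP exP ubP) => n /asboolP[W [WS dW]] maxn; exists W => v.
split=> [/WS //|Sv]; apply: contraT => vW.
have /maxn : P (\dim (<[v]> + W)).
  apply/asboolP; exists (<[v]> + W)%VS; split=> // w /memv_addP[u].
  by move=> /vlineP[a ->] [x /WS xW ->]; exact: Slin.
rewrite -dW leqNgt => /negP[]; rewrite ltn_neqAle dimvS ?addvSr // andbT.
apply: contra vW => dE.
have /eqP WE : (W == <[v]> + W)%VS by rewrite eqEdim addvSr (eqP dE) leqnn.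
by rewrite WE (subvP (addvSl _ _)) // memv_line.
Qed.

End VectorSubspace.

Section Defect.
Context {R : realType} {N : nat}.
Implicit Types U V E : 'M[R[i]]_N.

Definition sqmod_mx U : 'M[R]_N := \matrix_(i, j) (complex.Re `|U i j|) ^+ 2.

Definition dsqmod_mx U V : 'M[R]_N :=
  \matrix_(i, j) (2 * complex.Re ((U i j)^* * V i j)).

(* [dsqmod_mx U] is the real-linear part of [sqmod_mx] at [U], the remainder
   being quadratic in the increment. *)
Lemma sqmod_mxD U V :
  sqmod_mx (U + V) = sqmod_mx U + dsqmod_mx U V + sqmod_mx V.
Proof.
have sqE (z : R[i]) : (complex.Re `|z|) ^+ 2 = complex.Re z ^+ 2 + complex.Im z ^+ 2.
  by case: z => a b /=; rewrite sqr_sqrtr // addr_ge0 ?sqr_ge0.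
apply/matrixP=> i j; rewrite !mxE !sqE.
case: (U i j) (V i j) => a b [c d] /=.
by ring.
Qed.

Definition tangent_unitary U : set 'M[R[i]]_N :=
  [set V | exists2 E, E ^t* = - E & V = E *m U].

Lemma dsqmod_tangent_subspace U :
  is_subspace (dsqmod_mx U @` tangent_unitary U).
Proof.
split=> [|a _ _ [V [E Eskew VE] <-] [V' [E' E'skew VE'] <-]].
  exists 0; last by apply/matrixP=> i j; rewrite !mxE mulr0 mulr0.
  exists 0; last by rewrite mul0mx.
  by apply/matrixP=> i j; rewrite !mxE conjC0 oppr0.
exists (a%:C *: V + V'); last first.
  apply/matrixP=> i j; rewrite !mxE.
  case: (U i j) (V i j) (V' i j) => u1 u2 [v1 v2] [w1 w2] /=.
  by ring.
exists (a%:C *: E + E'); last by rewrite VE VE' mulmxDl scalemxAl.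
apply/matrixP=> i j; move/matrixP/(_ i j): Eskew; move/matrixP/(_ i j): E'skew.
rewrite !mxE rmorphD rmorphM /= => -> ->.
rewrite opprD -mulrN; congr (_ * _ + _).
by apply/eqP; rewrite eq_complex /= oppr0 !eqxx.
Qed.

Definition dsqmod_tangent U : {vspace 'M[R]_N} :=
  projT1 (cid (subspace_vspace (dsqmod_tangent_subspace U))).

Lemma mem_dsqmod_tangent U (A : 'M[R]_N) :
  A \in dsqmod_tangent U <-> (dsqmod_mx U @` tangent_unitary U) A.
Proof. by rewrite /dsqmod_tangent; case: cid => W /=. Qed.

Definition defect U : int := (N%:Z - 1) ^+ 2 - (\dim (dsqmod_tangent U))%:Z.

End Defect.

(* Indices in ['I_N] start at 0, so that [i * j] here is [(i-1)(j-1)] for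
   indices starting at 1. *)
Definition fourier_mx (R : realType) (N : nat) : 'M[R[i]]_N :=
  \matrix_(i, j) let t : R := 2 * pi / N%:R * (i * j)%:R in
    ((Num.sqrt (N%:R : R))^-1)%:C * (cos t +i* sin t).

Section FourierUnitary.
Context {R : realType}.

Let cis (t : R) : R[i] := cos t +i* sin t.

Let cisM (t : R) n : cis (t * n%:R) = cis t ^+ n.
Proof.
elim: n => [|n IHn]; first by rewrite mulr0 /cis cos0 sin0.
rewrite -natr1 mulrDr mulr1 exprSr -IHn /cis cosD sinD.
by apply/eqP; rewrite eq_complex /= eqxx /= addrC eqxx.
Qed.

Let cis_conjM (t : R) : cis t * (cis t)^* = 1.
Proof.
apply/eqP; rewrite eq_complex /= mulrN opprK -!expr2 cos2Dsin2 eqxx /=.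
by rewrite mulrN mulrC addNr.
Qed.

Lemma fourier_mx_unitary N : (0 < N)%N -> fourier_mx R N \is unitarymx.
Proof.
move=> N0; have N0R : 0 < N%:R :> R by rewrite ltr0n.
pose w := cis (2 * pi / N%:R).
have FE (i j : 'I_N) :
    fourier_mx R N i j = ((Num.sqrt (N%:R : R))^-1)%:C * w ^+ (i * j).
  by rewrite mxE -cisM.
have wN : w ^+ N = 1.
  by rewrite -cisM divfK ?gt_eqF // /cis mulrC mulr_natr cos2pi sin2pi.
have w_conjM : w * w^* = 1 by exact: cis_conjM.
have w1 m : (0 < m < N)%N -> w ^+ m != 1.
  move=> /andP[m0 mN]; rewrite -cisM eq_complex /= negb_and.
  pose x : R := pi / N%:R * m%:R.
  have -> : 2 * pi / N%:R * m%:R = x *+ 2 by rewrite /x; ring.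
  have x0 : 0 < x by rewrite !mulr_gt0 ?pi_gt0 ?invr_gt0 ?ltr0n.
  have xpi : x < pi.
    by rewrite /x -mulrA gtr_pMr ?pi_gt0 // mulrC ltr_pdivrMr // mul1r ltr_nat.
  have sx : 0 < sin x by apply: sin_gt0_pi; rewrite x0.
  rewrite cos_mulr2n cos2sin2; apply/orP; left; rewrite -subr_eq0.
  have -> : (1 - sin x ^+ 2) *+ 2 - 1 - 1 = - (sin x ^+ 2 *+ 2) by ring.
  by rewrite oppr_eq0 mulrn_eq0 /= expf_eq0 /= gt_eqF.
have w0 : w != 0.
  by apply: contra_eq_neq w_conjM => ->; rewrite mul0r eq_sym oner_eq0.
have wconj : w^* = w^-1 by rewrite -[RHS]mulr1 -w_conjM mulKf.
apply/unitarymxP/matrixP=> i j; rewrite [LHS]mxE [RHS]mxE.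
pose z := w ^+ i / w ^+ j.
have sE : ((Num.sqrt (N%:R : R))^-1)%:C * ((Num.sqrt (N%:R : R))^-1)%:C
    = N%:R^-1 :> R[i].
  by rewrite -rmorphM -invfM -expr2 sqr_sqrtr ?ltW // fmorphV rmorph_nat.
rewrite (eq_bigr (fun k : 'I_N => N%:R^-1 * z ^+ k)); last first.
  move=> k _; rewrite FE 2!mxE FE rmorphM rmorphXn /=.
  have -> : (((Num.sqrt (N%:R : R))^-1)%:C)^* = ((Num.sqrt (N%:R : R))^-1)%:C.
    by apply/eqP; rewrite eq_complex /= oppr0 !eqxx.
  by rewrite wconj mulrACA sE /z exprMn !exprM exprVn exprVn.
rewrite -mulr_sumr; have [eq_ij|neq_ij] := eqVneq i j.
  rewrite /z eq_ij divff ?expf_neq0 //.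
  rewrite (eq_bigr (fun=> 1)) => [|k _]; last by rewrite expr1n.
  by rewrite sumr_const card_ord mulVf // pnatr_eq0 -lt0n.
have zN : z ^+ N = 1.
  by rewrite /z exprMn exprVn -!exprM ![(_ * N)%N]mulnC !exprM wN !expr1n divr1.
have z1 : z != 1.
  rewrite /z -subr_eq0 -(mulfV (expf_neq0 j w0)) -mulrBl.
  rewrite mulf_neq0 ?invr_neq0 ?expf_neq0 // subr_eq0.
  have inj (a b : 'I_N) : (a < b)%N -> w ^+ a != w ^+ b.
    move=> ab; have bN := ltn_ord b; apply/eqP=> wab.
    have /eqP[] : w ^+ (b - a) != 1.
      by apply: w1; rewrite subn_gt0 ab (leq_ltn_trans (leq_subr _ _)).
    by apply: (mulIf (expf_neq0 a w0)); rewrite mul1r -exprD subnK // ltnW.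
  case: (ltngtP i j) => [/inj //|/inj|/val_inj/eqP]; first by rewrite eq_sym.
  by rewrite (negPf neq_ij).
have /eqP := subrX1 z N; rewrite zN subrr eq_sym mulf_eq0 subr_eq0 (negPf z1) /=.
by move=> /eqP ->; rewrite mulr0.
Qed.

End FourierUnitary.

(* Main.v *)
From HB Require Import structures.
Require Import Defs.
From mathcomp Require Import all_boot all_order all_algebra.
From mathcomp Require Import complex reals.
From mathcomp Require Import trigo ring.
Import Order.TTheory GRing.Theory Num.Theory.
Local Open Scope ring_scope.
Local Open Scope complex_scope.
Local Open Scope sesquilinear_scope.

(* A skew-Hermitian E is encoded by the real matrix G = Re E - Im E. Row i of
   Df(E F_N) is then 1/N times the Hartley transform (kernel cas = cos + sin) of
   d |-> G_{i,i+d} - G_{i-d,i}, indices modulo N. The Hartley transform is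
   injective, so the kernel of G |-> Df(E F_N) consists of the G for which every
   i |-> G_{i,i+d} is constant on the cosets of <d>; it has dimension
   S(N) = \sum_{d<N} gcd(N, d), which rank-nullity turns into (a). For (b), S is
   multiplicative by the Chinese remainder theorem, and on prime powers
   S(p^(k+1)) = p^(k+1) - p^k + p S(p^k). *)

(** * Gcd sums: multiplicativity and prime powers *)

Definition gcd_sum (n : nat) : nat := (\sum_(l < n) gcdn n l)%N.

Lemma gcdnMl_coprime (m n l : nat) :
  coprime m n -> gcdn (m * n) l = (gcdn m l * gcdn n l)%N.
Proof.
move=> cmn; apply/eqP; rewrite eqn_dvd; apply/andP; split.
  rewrite muln_gcdr !muln_gcdl !dvdn_gcd dvdn_gcdl /=.
  by rewrite dvdn_mulr ?dvdn_gcdr ?dvdn_mull ?dvdn_gcdr.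
rewrite dvdn_gcd dvdn_mul ?dvdn_gcdl //= Gauss_dvd ?dvdn_gcdr //.
exact: coprime_dvdl (dvdn_gcdl _ _) (coprime_dvdr (dvdn_gcdl _ _) cmn).
Qed.

(** Since gcd(m, l) depends only on l mod m, reindexing l by its pair of residues turns each term
    into gcd(m, i) gcd(n, j), and the double sum factors. *)
Lemma gcd_sumM (m n : nat) :
  coprime m n -> gcd_sum (m * n) = (gcd_sum m * gcd_sum n)%N.
Proof.
move=> cmn; have [->|m0] := posnP m; first by rewrite /gcd_sum !big_ord0.
have [->|n0] := posnP n; first by rewrite muln0 /gcd_sum !big_ord0 muln0.
have mn0 : (0 < m * n)%N by rewrite muln_gt0 m0.
pose crt (x : 'I_m * 'I_n) : 'I_(m * n) :=
  Ordinal (ltn_pmod (chinese m n x.1 x.2) mn0).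
pose res (l : 'I_(m * n)) : 'I_m * 'I_n :=
  (Ordinal (ltn_pmod l m0), Ordinal (ltn_pmod l n0)).
have crtK : cancel crt res.
  move=> [i j]; congr pair; apply: val_inj => /=.
    by rewrite modn_dvdm ?dvdn_mulr // chinese_modl // modn_small.
  by rewrite modn_dvdm ?dvdn_mull // chinese_modr // modn_small.
have resK : cancel res crt.
  by move=> l; apply: val_inj; rewrite /= -chinese_mod // modn_small.
rewrite /gcd_sum (reindex crt); last by exists res => ? _; rewrite ?crtK ?resK.
rewrite big_distrlr pair_big /=; apply: eq_bigr => -[i j] _ /=.
rewrite gcdnMl_coprime // -(gcdn_modr m) -(gcdn_modr n).
rewrite modn_dvdm ?dvdn_mulr // chinese_modl // gcdn_modr.
by rewrite modn_dvdm ?dvdn_mull // chinese_modr // gcdn_modr.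
Qed.

Lemma gcd_sum_primeX (p k : nat) : prime p ->
  (gcd_sum (p ^ k))%:R = (p ^ k)%:R * (1 + k%:R - k%:R / p%:R) :> rat.
Proof.
move=> pp; have p0 := prime_gt0 pp.
have pn0 : p%:R != 0 :> rat by rewrite pnatr_eq0 -lt0n.
elim: k => [|k IHk].
  by rewrite /gcd_sum expn0 big_ord1 gcdn0; field.
(* Split l by divisibility by p: a multiple l = p l' contributes p gcd(p^k, l'), and each of the
   p^(k+1) - p^k other l contributes 1. Adding p^k on the left avoids truncated subtraction. *)
suff /(congr1 (fun m : nat => m%:R : rat)) :
    (gcd_sum (p ^ k.+1) + p ^ k = p ^ k.+1 + p * gcd_sum (p ^ k))%N.
  rewrite !natrD natrM IHk expnS natrM => /(canRL (addrK _)) ->.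
  by rewrite -[k.+1]addn1 natrD; field.
have mult (F : nat -> nat) :
    (\sum_(l < p ^ k.+1 | p %| l) F l = \sum_(l < p ^ k) F (p * l))%N.
  rewrite expnSr.
  have h_subproof (l : 'I_(p ^ k)) : (p * l < p ^ k * p)%N.
    by rewrite mulnC ltn_pmul2r.
  pose h l := Ordinal (h_subproof l).
  have g_subproof (l : 'I_(p ^ k * p)) : (l %/ p < p ^ k)%N.
    by rewrite ltn_divLR.
  pose g l := Ordinal (g_subproof l).
  rewrite (reindex_onto h g) => [|l /divnK lE]; last first.
    by apply: val_inj; rewrite /= mulnC lE.
  apply: eq_bigl => l; rewrite /= dvdn_mulr //=; apply/eqP/val_inj.
  by rewrite /= mulKn.
have cop (l : 'I_(p ^ k.+1)) : ~~ (p %| l)%N -> gcdn (p ^ k.+1) l = 1%N.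
  by rewrite -prime_coprime // -(@coprime_pexpl k.+1) // => /eqP.
have gcd_mult : (\sum_(l < p ^ k) gcdn (p ^ k.+1) (p * l) = p * gcd_sum (p ^ k))%N.
  by rewrite big_distrr; apply: eq_bigr => l _; rewrite expnS -muln_gcdr.
have card_mult : (p ^ k = \sum_(l < p ^ k.+1 | p %| l) 1)%N.
  by rewrite (mult (fun=> 1%N)) sum_nat_const card_ord muln1.
have card_all : (p ^ k.+1 = \sum_(l < p ^ k.+1) 1)%N.
  by rewrite sum_nat_const card_ord muln1.
rewrite {1}/gcd_sum [in RHS]card_all.
rewrite !(bigID (fun l : 'I_(p ^ k.+1) => p %| l)%N xpredT) /=.
rewrite (mult (gcdn (p ^ k.+1))) gcd_mult (eq_bigr _ cop) -card_mult.
by rewrite -addnA addnC; congr (_ + _)%N; exact: addnC.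
Qed.

Lemma gcd_sum_prod (n : nat) (f : 'I_n -> nat) :
  (forall i j, i != j -> coprime (f i) (f j)) ->
  gcd_sum (\prod_(j < n) f j) = (\prod_(j < n) gcd_sum (f j))%N.
Proof.
elim: n f => [|n IHn] f cop; first by rewrite !big_ord0 /gcd_sum big_ord1.
rewrite !big_ord_recl gcd_sumM; last first.
  by elim/big_ind: _ => [|x y|i _]; rewrite ?coprimen1 ?coprimeMr ?cop // => -> ->.
by rewrite IHn // => i j ij; rewrite cop // (inj_eq lift_inj).
Qed.

(** [gcd_sum] also has the term l = 0, equal to n; dropping it and subtracting 1 from each of the n
    - 1 others gives - 2n + 1. *)
Lemma sum_gcdB1 (n : nat) : (0 < n)%N ->
  \sum_(1 <= l < n) ((gcdn n l)%:Z - 1) = (gcd_sum n)%:Z - n%:Z *+ 2 + 1.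
Proof.
move=> n0; rewrite /gcd_sum -(big_mkord xpredT (gcdn n)) big_ltn // gcdn0.
rewrite sumrB sumr_const_nat PoszD natz -subzn //.
rewrite (big_morph Posz PoszD (erefl 0%:Z)) mulr2n.
ring.
Qed.

Lemma gcd_sum_factor (N n : nat) (p k : 'I_n -> nat)
  (p_prime : forall j, prime (p j))
  (p_inj : injective p)
  (N_factor : N = (\prod_(j < n) p j ^ k j)%N) :
  (gcd_sum N)%:R =
    N%:R * \prod_(j < n) (1 + (k j)%:R - (k j)%:R / (p j)%:R) :> rat.
Proof.
rewrite N_factor gcd_sum_prod => [|i j ij].
  rewrite !natr_prod -big_split; apply: eq_bigr => j _ /=.
  by rewrite gcd_sum_primeX.
by rewrite coprimeXl // coprimeXr // prime_coprime // dvdn_prime2 // (inj_eq p_inj).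
Qed.

(** * The Hartley transform on Z_N *)

Section HartleyTransform.
Variables (R : realType) (m : nat).
(** The shape [m.+2] gives ['I_N] its ring structure, so index arithmetic is modulo N. *)
Local Notation N := m.+2.
Implicit Types x y d e : 'I_N.

Definition fcos x : R := cos (2 * pi / N%:R * x%:R).
Definition fsin x : R := sin (2 * pi / N%:R * x%:R).
Definition cas x : R := fcos x + fsin x.

Lemma invr_sqrt_natM (n : nat) :
  (Num.sqrt (n%:R : R))^-1 * (Num.sqrt (n%:R : R))^-1 = n%:R^-1.
Proof. by rewrite -invfM -expr2 sqr_sqrtr ?ler0n. Qed.

(** Reduction modulo N changes the angle by whole turns, so cosine and sine descend to Z_N. *)
Lemma angle_mod (a : nat) :
  2 * pi / N%:R * a%:R =
  2 * pi / N%:R * (a %% N)%:R + (pi *+ 2) *+ (a %/ N) :> R.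
Proof.
have N0 : N%:R != 0 :> R by rewrite pnatr_eq0.
by rewrite {1}(divn_eq a N) natrD natrM; move: N%:R N0 => r r0; field.
Qed.

Lemma cos_mod (a : nat) :
  cos (2 * pi / N%:R * (a %% N)%:R) = cos (2 * pi / N%:R * a%:R) :> R.
Proof. by rewrite (angle_mod a) (periodicn (@cosD2pi R)). Qed.

Lemma sin_mod (a : nat) :
  sin (2 * pi / N%:R * (a %% N)%:R) = sin (2 * pi / N%:R * a%:R) :> R.
Proof. by rewrite (angle_mod a) (periodicn (@sinD2pi R)). Qed.

Lemma fcosD x y : fcos (x + y) = fcos x * fcos y - fsin x * fsin y.
Proof. by rewrite /fcos cos_mod natrD mulrDr cosD. Qed.

Lemma fsinD x y : fsin (x + y) = fsin x * fcos y + fcos x * fsin y.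
Proof. by rewrite /fsin sin_mod natrD mulrDr sinD. Qed.

Lemma fcos2Dfsin2 x : fcos x ^+ 2 + fsin x ^+ 2 = 1.
Proof. exact: cos2Dsin2. Qed.

Lemma fcos0 : fcos 0 = 1. Proof. by rewrite /fcos mulr0 cos0. Qed.
Lemma fsin0 : fsin 0 = 0. Proof. by rewrite /fsin mulr0 sin0. Qed.

Lemma fcosN x : fcos (- x) = fcos x.
Proof.
have := fcosD x (- x); have := fsinD x (- x); have := fcos2Dfsin2 x.
rewrite subrr fcos0 fsin0 => h1 h2 h3.
(* The addition formulas at x + (- x) = 0 form a linear system in [fcos (- x)] and [fsin (- x)] of
   determinant 1, solved here by Cramer's rule. *)
transitivity (fcos (- x) * (fcos x ^+ 2 + fsin x ^+ 2)); first by rewrite h1 mulr1.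
transitivity (fcos x * (fcos x * fcos (- x) - fsin x * fsin (- x)) +
  fsin x * (fsin x * fcos (- x) + fcos x * fsin (- x))); first by ring.
by rewrite -h2 -h3; ring.
Qed.

Lemma fsinN x : fsin (- x) = - fsin x.
Proof.
have := fcosD x (- x); have := fsinD x (- x); have := fcos2Dfsin2 x.
rewrite subrr fcos0 fsin0 => h1 h2 h3.
transitivity (fsin (- x) * (fcos x ^+ 2 + fsin x ^+ 2)); first by rewrite h1 mulr1.
transitivity (fcos x * (fsin x * fcos (- x) + fcos x * fsin (- x)) -
  fsin x * (fcos x * fcos (- x) - fsin x * fsin (- x))); first by ring.
by rewrite -h2 -h3; ring.
Qed.

Lemma fourier_mxE (i j : 'I_N) :
  fourier_mx R N i j =
  ((Num.sqrt (N%:R : R))^-1)%:C * (fcos (i * j) +i* fsin (i * j)).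
Proof. by rewrite mxE /fcos /fsin cos_mod sin_mod. Qed.

(** Up to the factor N this is the inner product of rows d and 0 of the unitary matrix F_N, row 0
    being constant. *)
Lemma sum_fexp d :
  \sum_j (fcos (d * j) +i* fsin (d * j)) = (N%:R *+ (d == 0))%:C.
Proof.
have /unitarymxP/matrixP/(_ d 0) := @fourier_mx_unitary R N isT.
rewrite [LHS]mxE [RHS]mxE => /(congr1 (fun z => N%:R%:C * z)).
rewrite big_distrr /=.
rewrite (eq_bigr (fun j => fcos (d * j) +i* fsin (d * j))) => [->|j _].
  by case: eqP => _; rewrite ?mulr1 ?mulr0.
rewrite fourier_mxE 2!mxE fourier_mxE mul0r fcos0 fsin0.
have sE := invr_sqrt_natM N.
have N0 : N%:R != 0 :> R by rewrite pnatr_eq0.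
apply/eqP; rewrite eq_complex /=; apply/andP.
set s := (Num.sqrt _)^-1 in sE *.
have {}sE : N%:R * (s * s) = 1 :> R by rewrite sE mulfV.
split; apply/eqP.
  by transitivity (N%:R * (s * s) * fcos (d * j)); [ring | rewrite sE mul1r].
by transitivity (N%:R * (s * s) * fsin (d * j)); [ring | rewrite sE mul1r].
Qed.

Lemma sum_fcos d : \sum_j fcos (d * j) = N%:R *+ (d == 0).
Proof.
by have := congr1 (fun z => complex.Re z) (sum_fexp d); rewrite raddf_sum.
Qed.

Lemma sum_fsin d : \sum_j fsin (d * j) = 0.
Proof.
by have := congr1 (fun z => complex.Im z) (sum_fexp d); rewrite raddf_sum.
Qed.

Lemma casM x y : cas x * cas y = fcos (x - y) + fsin (x + y).
Proof. by rewrite fcosD fsinD fcosN fsinN /cas; ring. Qed.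

(** By [casM] the sum splits into a cosine sum at frequency d - e and a sine sum, which always
    vanishes. *)
Lemma cas_ortho d e : \sum_j cas (d * j) * cas (e * j) = N%:R *+ (d == e).
Proof.
under eq_bigr do rewrite casM -mulrBl -mulrDl.
by rewrite big_split /= sum_fcos sum_fsin addr0 subr_eq0.
Qed.

Lemma cas_inj (h : 'I_N -> R) :
  (forall j, \sum_d h d * cas (d * j) = 0) -> forall d, h d = 0.
Proof.
move=> h0 e; have N0 : N%:R != 0 :> R by rewrite pnatr_eq0.
apply: (mulIf N0); rewrite mul0r.
(* Pairing the transform with the row of frequency e isolates N times [h e], by orthogonality. *)
transitivity (\sum_j (\sum_d h d * cas (d * j)) * cas (e * j)); last first.
  by apply: big1 => j _; rewrite h0 mul0r.
under [RHS]eq_bigr do rewrite big_distrl /=.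
rewrite exchange_big /= (bigD1 e) //=.
under eq_bigr do rewrite -mulrA.
rewrite -big_distrr /= cas_ortho eqxx mulr1n big1 ?addr0 // => d de.
under eq_bigr do rewrite -mulrA.
by rewrite -big_distrr /= cas_ortho (negPf de) mulr0.
Qed.

End HartleyTransform.

Arguments fcos {R m} x.
Arguments fsin {R m} x.
Arguments cas {R m} x.
Arguments cas_inj {R m} h.

(** * Matrices constant along cosets on each cyclic diagonal *)

Section CyclicallyInvariant.
Variables (R : fieldType) (m : nat).
Local Notation N := m.+2.
Implicit Types (i d : 'I_N) (G : 'M[R]_N).

(* [(d; c)] stands for the coset of [c] modulo the subgroup [<d>] of Z_N, which
   is generated by [gcd(N, d)]. *)
Definition diag_index : finType := {d : 'I_N & 'I_(gcdn N d)}.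

Lemma card_diag_index : #|{: diag_index}| = gcd_sum N.
Proof.
rewrite card_tagged sumnE big_map big_enum /=.
by apply: eq_bigr => d _; rewrite card_ord.
Qed.

Lemma gcdn_diag_gt0 d : (0 < gcdn N d)%N.
Proof. by rewrite gcdn_gt0. Qed.

Definition diag_class i d : diag_index :=
  Tagged (fun d : 'I_N => 'I_(gcdn N d)) (Ordinal (ltn_pmod i (gcdn_diag_gt0 d))).

(** Here j - i is the index d of the cyclic diagonal through (i, j); the row vector f holds one free
    value per coset of <d>. *)
Definition diag_const_mx (f : 'rV[R]_#|{: diag_index}|) : 'M[R]_N :=
  \matrix_(i, j) f 0 (enum_rank (diag_class i (j - i))).

Lemma diag_const_mx_is_linear : linear diag_const_mx.
Proof. by move=> a f g; apply/matrixP=> i j; rewrite !mxE. Qed.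

HB.instance Definition _ :=
  GRing.isLinear.Build R _ _ _ diag_const_mx diag_const_mx_is_linear.

(** Bezout over the naturals gives t with N dividing gcd(N, d) + t d, whence the minus sign. *)
Lemma gcdn_Zp_multiple d : exists t, (gcdn N d)%:R = - (d *+ t) :> 'I_N.
Proof.
have [t _ /dvdnP[q E]] := @Bezoutl N d isT.
exists t; apply/eqP; rewrite -addr_eq0 -[d *+ t]mulr_natl.
rewrite -[d in _ * d]natr_Zp -natrM -natrD E natrM.
by rewrite -[N%:R]/(N%:R : 'Z_N) pchar_Zp // mulr0.
Qed.

(** The hypothesis makes i |-> G_{i,i+d} invariant under i |-> i - d, hence under all of <d>, which
    contains gcd(N, d). *)
Lemma mx_shift_inv G :
  (forall i d, G i (i + d) = G (i - d) i) ->
  forall i d, G i (i + d) = G (inord (i %% gcdn N d)) (inord (i %% gcdn N d) + d).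
Proof.
move=> Ginv i d.
have shift x t : G (x - d *+ t) (x - d *+ t + d) = G x (x + d).
  elim: t => [|t IHt]; first by rewrite subr0.
  by rewrite -IHt [RHS]Ginv mulrSr opprD addrA subrK.
have [t gE] := gcdn_Zp_multiple d.
set g := gcdn N d in gE *; set c := inord _.
have iE : i = c - d *+ (t * (i %/ g)).
  rewrite mulrnA -mulNrn -gE -[i in LHS]natr_Zp {1}(divn_eq i g) natrD natrM.
  rewrite addrC mulr_natl; congr (_ + _).
  rewrite -[RHS]natr_Zp inordK //.
  exact: leq_ltn_trans (leq_mod _ _) (ltn_ord i).
by rewrite [in LHS]iE shift.
Qed.

Lemma diag_const_mxP G :
  G \in limg (linfun diag_const_mx) <-> (forall i d, G i (i + d) = G (i - d) i).
Proof.
split=> [/memv_imgP[f _ ->] i d|Ginv].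
  rewrite lfunE /= !mxE addrAC subrr add0r subKr.
  congr (f 0 (enum_rank _)).
  congr Tagged; apply: val_inj => /=.
  set g := gcdn _ _.
  (* Subtracting d in Z_N adds N - d to the representative, a multiple of gcd(N, d), so the coset
     does not change. *)
  have /eqP gNd : (g %| N - d)%N by rewrite dvdn_sub ?dvdn_gcdl ?dvdn_gcdr.
  rewrite modn_dvdm ?dvdn_gcdl //.
  by rewrite -(modnDmr i) modn_dvdm ?dvdn_gcdl // gNd addn0.
(* The preimage reads G at the least representative of each coset. *)
pose f : 'rV[R]_#|{: diag_index}| := \row_x
  let s : diag_index := enum_val x in G (inord (tagged s)) (inord (tagged s) + tag s).
apply/memv_imgP; exists f; first exact: memvf.
apply/matrixP=> i j; rewrite lfunE /= !mxE enum_rankK /=.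
by rewrite -[RHS](mx_shift_inv _ Ginv i (j - i)) addrC subrK.
Qed.

(** Every coordinate (d; c) of f is visible as the entry (c, c + d). *)
Lemma diag_const_mx_inj : lker (linfun diag_const_mx) = 0%VS.
Proof.
apply/eqP; rewrite -subv0; apply/subvP=> f; rewrite memv_ker lfunE memv0 /=.
move=> /eqP/matrixP f0; apply/eqP/rowP=> x; rewrite !mxE.
rewrite -[x]enum_valK; case: (enum_val x) => d c.
have := f0 (inord c) (inord c + d); rewrite !mxE => <-.
congr (f 0 (enum_rank _)).
rewrite /diag_class addrC addKr; congr Tagged; apply: val_inj => /=.
have cN : (c < N)%N.
  apply: leq_trans (ltn_ord c) _; exact: dvdn_leq (dvdn_gcdl _ _).
by rewrite inordK // modn_small.
Qed.

Lemma dim_diag_const : \dim (limg (linfun diag_const_mx)) = gcd_sum N.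
Proof.
rewrite limg_dim_eq ?diag_const_mx_inj ?capv0 // dimvf dim_matrix mul1r.
exact: card_diag_index.
Qed.

End CyclicallyInvariant.

(** * The differential at F_N and its rank *)

Section DefectFourier.
Variables (R : realType) (m : nat).
Local Notation N := m.+2.

Definition hartley_dsqmod (G : 'M[R]_N) : 'M[R]_N :=
  \matrix_(i, j) (N%:R^-1 * \sum_k
    (G i k * cas ((k - i) * j) - G k i * cas ((i - k) * j))).

Lemma hartley_dsqmod_is_linear : linear hartley_dsqmod.
Proof.
move=> a G H; apply/matrixP=> i j; rewrite !mxE mulrCA -mulrDr; congr (_ * _).
rewrite big_distrr -big_split; apply: eq_bigr => k _ /=.
by rewrite !mxE; ring.
Qed.

HB.instance Definition _ :=
  GRing.isLinear.Build R _ _ _ hartley_dsqmod hartley_dsqmod_is_linear.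

(** With E_{ik} = a + b i and t the angle of (k - i) j, the k-th terms on both sides equal 2 (a cos
    t - b sin t) / N: skewness turns G_{ik} = a - b into G_{ki} = - a - b. *)
Lemma dsqmod_skew (E : 'M[R[i]]_N) : E ^t* = - E ->
  dsqmod_mx (fourier_mx R N) (E *m fourier_mx R N) =
  hartley_dsqmod (\matrix_(i, j) (complex.Re (E i j) - complex.Im (E i j))).
Proof.
move=> Eskew; apply/matrixP=> i j; rewrite [LHS]mxE [RHS]mxE [(_ *m _) i j]mxE.
rewrite big_distrr raddf_sum /= !big_distrr; apply: eq_bigr => k _ /=.
rewrite !fourier_mxE !mxE -invr_sqrt_natM !mulrBl /cas !fcosD !fsinD !fcosN !fsinN.
have /matrixP/(_ k i) := Eskew; rewrite !mxE.
case: (E i k) (E k i) => a b [a' b'] /eqP; rewrite eq_complex /=.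
by move=> /andP[/eqP -> /eqP /oppr_inj ->]; ring.
Qed.

(* [Re E] and [- Im E] are the antisymmetric and symmetric parts of [G]. *)
Lemma skew_of_real (G : 'M[R]_N) : exists2 E : 'M[R[i]]_N, E ^t* = - E &
  G = \matrix_(i, j) (complex.Re (E i j) - complex.Im (E i j)).
Proof.
exists (\matrix_(i, j) ((G i j - G j i) / 2 +i* (- (G i j + G j i) / 2))).
  apply/matrixP=> i j; rewrite !mxE; apply/eqP; rewrite eq_complex /=.
  by apply/andP; split; apply/eqP; field.
by apply/matrixP=> i j; rewrite !mxE /=; field.
Qed.

(** Substituting k = i + d in the first half and k = i - d in the second gives both the same
    kernel. *)
Lemma hartley_dsqmodE (G : 'M[R]_N) i j : hartley_dsqmod G i j =
  N%:R^-1 * \sum_d (G i (i + d) - G (i - d) i) * cas (d * j).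
Proof.
rewrite mxE; congr (_ * _); rewrite sumrB.
rewrite (reindex_inj (addrI i)) /= [X in _ - X](reindex_inj (subrI i)) /=.
rewrite -sumrB; apply: eq_bigr => d _.
by rewrite addrAC subrr add0r subKr mulrBl.
Qed.

Lemma dsqmod_tangent_fourier :
  dsqmod_tangent (fourier_mx R N) = limg (linfun hartley_dsqmod).
Proof.
apply/vspaceP=> A; apply/idP/idP.
  move=> /mem_dsqmod_tangent[_ [E Eskew ->] <-].
  rewrite dsqmod_skew //; apply/memv_imgP; eexists; first exact: memvf.
  by rewrite lfunE.
move=> /memv_imgP[G _ ->]; apply/mem_dsqmod_tangent; rewrite lfunE /=.
have [E Eskew ->] := skew_of_real G.
by exists (E *m fourier_mx R N); [exists E | rewrite dsqmod_skew].
Qed.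

Lemma lker_hartley_dsqmod :
  lker (linfun hartley_dsqmod) = limg (linfun (@diag_const_mx R m)).
Proof.
have N0 : N%:R^-1 != 0 :> R by rewrite invr_eq0 pnatr_eq0.
apply/vspaceP=> G; rewrite memv_ker lfunE /=; apply/eqP/idP.
  move=> /matrixP G0; apply/diag_const_mxP => i d; apply/eqP; rewrite -subr_eq0.
  apply/eqP; apply: (cas_inj (fun d => G i (i + d) - G (i - d) i)) => j.
  by apply: (mulfI N0); rewrite mulr0 -hartley_dsqmodE G0 mxE.
move=> /diag_const_mxP Ginv; apply/matrixP=> i j.
rewrite hartley_dsqmodE big1 ?mulr0 ?mxE // => d _.
by rewrite Ginv subrr mul0r.
Qed.

(** Rank-nullity on the N^2-dimensional space of real matrices gives rank N^2 - S(N), and (N - 1)^2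
    - N^2 = - 2N + 1. *)
Lemma defect_fourier :
  defect (fourier_mx R N) = (gcd_sum N)%:Z - N%:Z *+ 2 + 1.
Proof.
have := limg_ker_dim (linfun hartley_dsqmod) fullv.
rewrite capfv lker_hartley_dsqmod dim_diag_const dimvf dim_matrix.
rewrite -dsqmod_tangent_fourier /defect => /(congr1 Posz).
rewrite PoszD PoszM => /(canRL (addKr _)) ->.
ring.
Qed.

End DefectFourier.

Theorem theorem5p3 (R : realType) (N n : nat) (p k : 'I_n -> nat)
  (hN : (2 <= N)%N)
  (p_prime : forall j, prime (p j))
  (p_decr : forall i j : 'I_n, (i < j)%N -> (p j < p i)%N)
  (k_gt0 : forall j, (0 < k j)%N)
  (N_factor : N = (\prod_(j < n) p j ^ k j)%N) :
  defect (fourier_mx R N) = \sum_(1 <= l < N) ((gcdn N l)%:Z - 1) /\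
  (defect (fourier_mx R N))%:~R =
    N%:R * (\prod_(j < n) (1 + (k j)%:R - (k j)%:R / (p j)%:R) - 2) + 1 :> rat.
Proof.
have p_inj : injective p.
  move=> i j; case: (ltngtP i j) => [/p_decr|/p_decr|/val_inj//].
    by move=> + pij; rewrite pij ltnn.
  by move=> + pij; rewrite pij ltnn.
have dE : defect (fourier_mx R N) = (gcd_sum N)%:Z - N%:Z *+ 2 + 1.
  by case: N hN {N_factor} => [|[|m]] // _; exact: defect_fourier.
split; first by rewrite dE sum_gcdB1 // ltnW.
rewrite dE !rmorphD /= rmorphN /= rmorphMn /= -!pmulrn.
rewrite (gcd_sum_factor _ _ _ _ p_prime p_inj N_factor).
ring.
Qed.
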